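(* Let $X,Y,Z$ be simply connected CW complexes with rational homology of finite type, and with $\dim G(X_{\mathbb{Q}})<\infty$ and $\dim G(Y_{\mathbb{Q}})<\infty$. For any based maps $g:X\to Y$ and $f:Y\to Z$, one has $$o(f\circ g)\le o(f)+o(g).$$
   Context: For a path connected based CW complex $B$, the $n$th Gottlieb group $G_n(B)\subset \pi_n(B)$ is the subgroup of homotopy classes of based maps $a:S^n\to B$ such that $(a|\mathrm{id}_B):S^n\vee B\to B$ extends to a map $S^n\times B\to B$. Put $G(B)=\bigoplus_{n>0}G_n(B)$. For a based map $f:E\to B$, define $$O_n(f):=\mathrm{Im}\bigl(G_n(E)\xrightarrow{\pi_n(f)}\pi_n(B)\twoheadrightarrow \pi_n(B)/G_n(B)\bigr),\qquad O(f):=\bigoplus_{n>0}O_n(f).$$ For simply connected spaces, $E_{\mathbb{Q}},B_{\mathbb{Q}}$ denote the rationalizations and $f_{\mathbb{Q}}:E_{\mathbb{Q}}\to B_{\mathbb{Q}}$ the rationalization of $f$. Then $O(f_{\mathbb{Q}})=\bigoplus_{n>0}\mathrm{Im}\bigl(G_n(E_{\mathbb{Q}})\xrightarrow{\pi_n(f_{\mathbb{Q}})}\pi_n(B_{\mathbb{Q}})\twoheadrightarrow \pi_n(B_{\mathbb{Q}})/G_n(B_{\mathbb{Q}})\bigr)$ is a graded rational vector space, and $o(f):=\dim_{\mathbb{Q}} O(f_{\mathbb{Q}})$. *)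

(* Defs.v *)
From HB Require Import structures.
From mathcomp Require Import all_boot all_order all_algebra.
From mathcomp Require Import generic_quotient.
From mathcomp Require Import all_classical all_reals all_analysis.
From mathcomp.multinomials Require Import freeg.

Set Implicit Arguments.
Unset Strict Implicit.
Unset Printing Implicit Defensive.

Import Order.TTheory GRing.Theory Num.Theory.
Import numFieldNormedType.Exports.

Local Open Scope classical_set_scope.
Local Open Scope ring_scope.
Local Open Scope quotient_scope.

Section continuity_lemmas.

Lemma paste_continuous (T U : topologicalType) (A B : set T) (f g h : T -> U) :
  closed A -> closed B -> (forall x, A x \/ B x) ->
  continuous g -> continuous h ->
  (forall x, A x -> f x = g x) -> (forall x, B x -> f x = h x) ->
  continuous f.
Proof.
move=> cA cB AB cg ch fg fh; apply/continuous_subspace_setT.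
have -> : setT = A `|` B by apply/esym/seteqP; split=> // x _; exact: AB.
apply: withinU_continuous => //.
- apply: (@subspace_eq_continuous _ _ _ g); last exact: continuous_subspaceT.
  by move=> x /set_mem Ax; exact: (esym (fg _ Ax)).
- apply: (@subspace_eq_continuous _ _ _ h); last exact: continuous_subspaceT.
  by move=> x /set_mem Bx; exact: (esym (fh _ Bx)).
Qed.

Lemma comp_continuous (T U V : topologicalType) (f : T -> U) (g : U -> V) :
  continuous f -> continuous g -> continuous (fun x => g (f x)).
Proof. by move=> cf cg x; apply: continuous_comp; [exact: cf|exact: cg]. Qed.

Lemma fst_continuous (T U : topologicalType) : continuous (fst : T * U -> T).
Proof. by move=> x; exact: cvg_fst. Qed.

Lemma snd_continuous (T U : topologicalType) : continuous (snd : T * U -> U).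
Proof. by move=> x; exact: cvg_snd. Qed.

Lemma pair_continuous (T U V : topologicalType) (f : T -> U) (g : T -> V) :
  continuous f -> continuous g -> continuous (fun x => (f x, g x)).
Proof. by move=> cf cg x; apply: cvg_pair; [exact: cf|exact: cg]. Qed.

Lemma mx_continuous (T U : topologicalType) m n (f : T -> 'M[U]_(m, n)) :
  (forall i j, continuous (fun x => f x i j)) -> continuous f.
Proof.
move=> cf x A [P Pf PA].
have : \forall y \near x, forall i j, P i j (f y i j).
  apply: filter_forall => i; apply: filter_forall => j.
  exact: (cf i j x _ (Pf i j)).
by apply: filterS => y Py; apply: PA.
Qed.

Lemma set_val_continuous (T : topologicalType) (A : set T) :
  continuous (set_val : A -> T).
Proof. exact: initial_continuous. Qed.

Lemma to_set_type_continuous (T U : topologicalType) (A : set U) (f : T -> A) :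
  continuous (set_val \o f) -> continuous f.
Proof. exact: continuous_comp_initial. Qed.

End continuity_lemmas.

Section unit_interval.
Context (R : realType).

Definition I01 : Type := set_type [set t : R | 0 <= t <= 1].
HB.instance Definition _ := Topological.on I01.

Lemma clamp_subproof (x : R) : 0 <= Num.max 0 (Num.min 1 x) <= 1.
Proof. by rewrite le_max lexx ge_max ler01/= ge_min lexx. Qed.

(** The retraction of the real line onto the unit interval; it lets the
    piecewise affine changes of variable below be defined on all of [I01]. *)
Definition clamp (x : R) : I01 :=
  exist (fun t => t \in [set t : R | 0 <= t <= 1]) _ (mem_set (clamp_subproof x)).

Definition I0 : I01 := clamp 0.
Definition I1 : I01 := clamp 1.

Lemma I01_itv (t : I01) : 0 <= set_val t <= 1.
Proof. exact: (set_mem (valP t)). Qed.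

Lemma clampE x : 0 <= x <= 1 -> set_val (clamp x) = x.
Proof. by move=> /andP[x0 x1]; rewrite set_valE /= min_r// max_r. Qed.

Lemma I0E : set_val I0 = 0 :> R.
Proof. by apply: clampE; rewrite lexx ler01. Qed.

Lemma I1E : set_val I1 = 1 :> R.
Proof. by apply: clampE; rewrite lexx ler01. Qed.

Lemma clamp_ge1 x : 1 <= x -> clamp x = I1.
Proof.
by move=> x1; apply/val_inj => /=; rewrite !min_l.
Qed.

Lemma clamp_le0 x : x <= 0 -> clamp x = I0.
Proof.
move=> x0; apply/val_inj => /=.
by rewrite !min_r ?max_l ?ler01// (le_trans x0).
Qed.

Lemma clampK (t : I01) : clamp (set_val t) = t.
Proof. by apply/val_inj; exact: clampE (I01_itv t). Qed.

Lemma clamp_continuous : continuous clamp.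
Proof.
apply: to_set_type_continuous => x.
rewrite /comp/=; apply: continuous_max; first exact: cvg_cst.
by apply: continuous_min; [exact: cvg_cst|exact: cvg_id].
Qed.

Lemma I01_val_continuous : continuous (set_val : I01 -> R).
Proof. exact: set_val_continuous. Qed.

End unit_interval.
Arguments I0 {R}.
Arguments I1 {R}.

(** A based space is a [ptopologicalType]; its base point is [point]. *)

Record bmap (X Y : ptopologicalType) := Bmap {
  bmap_fun :> X -> Y ;
  bmap_continuous : continuous bmap_fun ;
  bmap_point : bmap_fun point = point }.

HB.instance Definition _ (X Y : ptopologicalType) := gen_eqMixin (bmap X Y).
HB.instance Definition _ (X Y : ptopologicalType) := gen_choiceMixin (bmap X Y).

Section bmap_comp.
Context (X Y Z : ptopologicalType) (f : bmap Y Z) (g : bmap X Y).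

Lemma bmap_comp_continuous : continuous (f \o g).
Proof.
by move=> x; apply: continuous_comp; exact: bmap_continuous.
Qed.

Lemma bmap_comp_point : (f \o g) point = point.
Proof. by rewrite /= !bmap_point. Qed.

Definition bmap_comp : bmap X Z := Bmap bmap_comp_continuous bmap_comp_point.

End bmap_comp.

Section bmap_cst.
Context (X Y : ptopologicalType).

Lemma bmap_cst_continuous : continuous (fun _ : X => point : Y).
Proof. by move=> x; apply: cvg_cst. Qed.

Definition bmap_cst : bmap X Y := Bmap bmap_cst_continuous erefl.

End bmap_cst.

Section based_homotopy.
Context (R : realType) (X Y : ptopologicalType).

Definition homotopic (a b : bmap X Y) : Prop :=
  exists H : I01 R * X -> Y,
    [/\ continuous H, forall x, H (I0, x) = a x, forall x, H (I1, x) = b x &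
        forall t, H (t, point) = point].

Lemma homotopic_refl a : homotopic a a.
Proof.
exists (fun p => a p.2); split => [|//|//|t]; last exact: bmap_point.
exact: (comp_continuous (@snd_continuous _ _) (@bmap_continuous _ _ a)).
Qed.

Lemma reparam_homotopy (phi : R -> R) (H : I01 R * X -> Y) :
  continuous phi -> continuous H ->
  continuous (fun p : I01 R * X => H (clamp (phi (set_val p.1)), p.2)).
Proof.
move=> cphi cH; apply: (comp_continuous _ cH).
apply: pair_continuous; last exact: snd_continuous.
apply: (comp_continuous (g := fun t : I01 R => clamp (phi (set_val t)))).
  exact: fst_continuous.
apply: (comp_continuous (g := fun t => clamp (phi t))).
  exact: I01_val_continuous.
exact: (comp_continuous cphi (@clamp_continuous R)).
Qed.

Lemma homotopic_sym a b : homotopic a b -> homotopic b a.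
Proof.
move=> [H [cH Ha Hb Hpt]].
exists (fun p : I01 R * X => H (clamp (1 - set_val p.1), p.2)); split => //.
- apply: (@reparam_homotopy (fun t => 1 - t)) => // t.
  by apply: cvgB; [exact: cvg_cst|exact: cvg_id].
- by move=> x /=; rewrite -Hb I0E subr0.
- by move=> x /=; rewrite -Ha I1E subrr.
Qed.

Lemma homotopic_trans b a c : homotopic a b -> homotopic b c -> homotopic a c.
Proof.
move=> [H [cH Ha Hb Hpt]] [K [cK Kb Kc Kpt]].
pose h2 : R := 2^-1.
exists (fun p : I01 R * X => if set_val p.1 <= h2 then H (clamp (2 * set_val p.1), p.2)
                 else K (clamp (2 * set_val p.1 - 1), p.2)).
have cv : continuous (fun p : I01 R * X => set_val p.1 : R).
  exact: (comp_continuous (@fst_continuous _ _) (@I01_val_continuous R)).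
have c2 : continuous (fun t : R => 2 * t).
  by move=> t; apply: cvgM; [exact: cvg_cst|exact: cvg_id].
split.
- apply: (@paste_continuous _ _ ((fun p : I01 R * X => set_val p.1 : R) @^-1` [set x | x <= h2])
    ((fun p : I01 R * X => set_val p.1 : R) @^-1` [set x | h2 <= x]) _
    (fun p : I01 R * X => H (clamp (2 * set_val p.1), p.2))
    (fun p : I01 R * X => K (clamp (2 * set_val p.1 - 1), p.2))).
  + by apply: closed_comp; [move=> ? _; exact: cv|exact: closed_le].
  + by apply: closed_comp; [move=> ? _; exact: cv|exact: closed_ge].
  + by move=> p /=; case: (leP (set_val p.1) h2) => [|/ltW]; [left|right].
  + exact: (@reparam_homotopy (fun t => 2 * t)).
  + apply: (@reparam_homotopy (fun t => 2 * t - 1)) => // t.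
    by apply: cvgB; [exact: c2|exact: cvg_cst].
  + by move=> p /= ->.
  + move=> p /= hp; case: ifPn => // ph.
    have -> : set_val p.1 = h2 by apply/eqP; rewrite eq_le ph hp.
    by rewrite /h2 mulfV// subrr clamp_ge1// clamp_le0// Hb Kb.
- by move=> x /=; rewrite I0E mulr0 invr_ge0 ler0n -Ha.
- move=> x /=; rewrite I1E ifF; last by apply/negbTE; rewrite -ltNge invf_lt1 ?ltr1n.
  by rewrite mulr1 -Kc; congr (K (clamp _, _)); rewrite -[2]/(1 + 1) addrK.
- by move=> t /=; case: ifP.
Qed.

Definition homotopicb (a b : bmap X Y) : bool := `[< homotopic a b >].

Lemma homotopicb_refl : reflexive homotopicb.
Proof. by move=> a; apply/asboolP; exact: homotopic_refl. Qed.

Lemma homotopicb_sym : symmetric homotopicb.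
Proof. by move=> a b; apply/asboolP/asboolP; exact: homotopic_sym. Qed.

Lemma homotopicb_trans : transitive homotopicb.
Proof.
by move=> b a c /asboolP ab /asboolP bc; apply/asboolP/(homotopic_trans ab bc).
Qed.

Canonical homotopicb_equiv :=
  EquivRel homotopicb homotopicb_refl homotopicb_sym homotopicb_trans.

End based_homotopy.

Section sphere.
Context (R : realType).

Definition cube n : Type := set_type [set t : 'rV[R]_n | forall i, 0 <= t 0 i <= 1].
HB.instance Definition _ n := Topological.on (cube n).

Lemma cube0_subproof n (i : 'I_n) : 0 <= (0 : 'rV[R]_n) 0 i <= 1.
Proof. by rewrite mxE lexx ler01. Qed.

Definition cube0 n : cube n :=
  exist (fun t => t \in [set t : 'rV[R]_n | forall i, 0 <= t 0 i <= 1]) _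
    (mem_set (@cube0_subproof n)).
HB.instance Definition _ n := isPointed.Build (cube n) (cube0 n).

Definition cube_boundary n (t : cube n) : bool :=
  [exists i, (set_val t 0 i == 0) || (set_val t 0 i == 1)].

Definition sphere_rel n (s t : cube n) : bool :=
  (s == t) || (cube_boundary s && cube_boundary t).

Lemma sphere_rel_refl n : reflexive (@sphere_rel n).
Proof. by move=> s; rewrite /sphere_rel eqxx. Qed.

Lemma sphere_rel_sym n : symmetric (@sphere_rel n).
Proof. by move=> s t; rewrite /sphere_rel eq_sym andbC. Qed.

Lemma sphere_rel_trans n : transitive (@sphere_rel n).
Proof.
move=> t s u /orP[/eqP->//|/andP[bs bt]] /orP[/eqP<-|/andP[_ bu]].
  by rewrite /sphere_rel bs bt orbT.
by rewrite /sphere_rel bs bu orbT.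
Qed.

Canonical sphere_rel_equiv n :=
  EquivRel (@sphere_rel n) (@sphere_rel_refl n) (@sphere_rel_sym n)
    (@sphere_rel_trans n).

(** The sphere of dimension [n], [n > 0], as the cube with its boundary
    collapsed to the base point. *)
Definition sphere n : Type := quotient_topology {eq_quot @sphere_rel n}.
HB.instance Definition _ n := Topological.on (sphere n).
HB.instance Definition _ n := Quotient.on (sphere n).
HB.instance Definition _ n := Pointed.on (sphere n).

Definition sphere_pi n (t : cube n) : sphere n := \pi_(sphere n) t.

Lemma sphere_pi_continuous n : continuous (@sphere_pi n).
Proof. exact: pi_continuous. Qed.

Lemma sphere_piP n (s t : cube n) :
  reflect (sphere_pi s = sphere_pi t) (sphere_rel s t).
Proof. exact: (eqmodP (sphere_rel_equiv n) s t). Qed.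

Lemma sphere_pi_point n : point = sphere_pi (cube0 n) :> sphere n.
Proof. by []. Qed.

Lemma sphere_pi_boundary n (t : cube n) :
  cube_boundary t -> sphere_pi t = point.
Proof.
move=> bt; rewrite sphere_pi_point; apply/sphere_piP/orP; right; rewrite bt /=.
have /existsP[i _] := bt.
by apply/existsP; exists i; rewrite set_valE /= mxE eqxx.
Qed.

Lemma sphere_bmap_continuous n (Y : topologicalType) (c : cube n -> Y) (y : Y) :
  continuous c -> (forall t, cube_boundary t -> c t = y) ->
  continuous (fun s : sphere n => c (repr s)).
Proof.
move=> cc cb; apply: (repr_comp_continuous cc) => s t.
by move=> /eqP /sphere_piP /orP[/eqP->//|/andP[bs bt]]; rewrite !cb.
Qed.

(** The based map out of the sphere given by a map of pairs out of the cube. *)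
Section sphere_bmap.
Context n (Y : ptopologicalType) (c : cube n.+1 -> Y).
Hypotheses (cc : continuous c) (cb : forall t, cube_boundary t -> c t = point).

Lemma sphere_bmap_point : c (repr (point : sphere n.+1)) = point.
Proof.
apply: cb.
have b0 : cube_boundary (cube0 n.+1).
  by apply/existsP; exists ord0; rewrite set_valE /= mxE eqxx.
have : sphere_pi (repr (point : sphere n.+1)) = sphere_pi (cube0 n.+1).
  by rewrite /sphere_pi reprK.
by move=> /sphere_piP /orP[/eqP->|/andP[]].
Qed.

Definition sphere_bmap : bmap (sphere n.+1) Y :=
  Bmap (sphere_bmap_continuous cc cb) sphere_bmap_point.

End sphere_bmap.

(** Applies [phi], clamped to the unit interval, to the first coordinate. In
    [concat_cube] and [reverse_cube] the clamping is never effective. *)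
Definition reparam_row n (phi : R -> R) (t : cube n.+1) : 'rV[R]_n.+1 :=
  \row_j if j == ord0 then set_val (clamp (phi (set_val t 0 ord0)))
         else set_val t 0 j.

Lemma reparam_subproof n (phi : R -> R) (t : cube n.+1) i :
  0 <= reparam_row phi t 0 i <= 1.
Proof.
rewrite mxE; case: ifP => _; first exact: I01_itv.
exact: (set_mem (valP t)).
Qed.

Definition reparam n (phi : R -> R) (t : cube n.+1) : cube n.+1 :=
  exist (fun t => t \in [set t : 'rV[R]_n.+1 | forall i, 0 <= t 0 i <= 1]) _
    (mem_set (reparam_subproof phi t)).

Lemma cube_coord_continuous n (i : 'I_n) :
  continuous (fun t : cube n => set_val t 0 i : R).
Proof.
apply: (comp_continuous (g := fun t : 'rV[R]_n => t 0 i)).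
  exact: set_val_continuous.
exact: coord_continuous.
Qed.

Lemma reparam_continuous n (phi : R -> R) :
  continuous phi -> continuous (@reparam n phi).
Proof.
move=> cphi; apply: to_set_type_continuous.
have -> : set_val \o @reparam n phi = reparam_row phi.
  by apply/funext => t; rewrite /comp set_valE.
apply: mx_continuous => i j.
have -> : (fun t => reparam_row phi t i j) =
    if j == ord0 then fun t : cube n.+1 => set_val (clamp (phi (set_val t 0 ord0)))
    else fun t : cube n.+1 => set_val t 0 j.
  by apply/funext => t; rewrite mxE; case: ifP.
case: ifP => _; last exact: cube_coord_continuous.
apply: (comp_continuous (g := fun x => set_val (clamp (phi x)))).
  exact: cube_coord_continuous.
apply: (comp_continuous (f := phi) (g := fun x => set_val (clamp x))) => //.
exact: (comp_continuous (@clamp_continuous R) (@I01_val_continuous R)).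
Qed.

Lemma reparam_boundary n (phi : R -> R) (t : cube n.+1) (i : 'I_n.+1) :
  (if i == ord0 then (phi (set_val t 0 ord0) <= 0) || (1 <= phi (set_val t 0 ord0))
   else (set_val t 0 i == 0) || (set_val t 0 i == 1)) ->
  cube_boundary (reparam phi t).
Proof.
move=> h; apply/existsP; exists i; rewrite set_valE /= mxE; move: h.
case: ifP => // _ /orP[h|h]; first by rewrite (clamp_le0 h) I0E eqxx.
by rewrite (clamp_ge1 h) I1E eqxx orbT.
Qed.

End sphere.

Section homotopy_group.
Context (R : realType) (n : nat) (X : ptopologicalType).
Implicit Types a b : bmap (sphere R n.+1) X.

(** The set of based homotopy classes of based maps from the sphere of
    dimension [n + 1] to [X], i.e. the homotopy group in degree [n + 1]. *)
Definition homotopy_group : Type :=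
  {eq_quot (@homotopicb R (sphere R n.+1) X)}.
HB.instance Definition _ := Choice.on homotopy_group.
HB.instance Definition _ := EqQuotient.on homotopy_group.

Definition hclass a : homotopy_group := \pi_homotopy_group a.

Definition concat_cube a b (t : cube R n.+1) : X :=
  if set_val t 0 ord0 <= 2^-1 :> R
  then a (sphere_pi (reparam (fun x => 2 * x) t))
  else b (sphere_pi (reparam (fun x => 2 * x - 1) t)).

Lemma reparam_bmap_continuous a phi : continuous phi ->
  continuous (fun t : cube R n.+1 => a (sphere_pi (reparam phi t))).
Proof.
move=> cphi.
apply: (comp_continuous (g := fun t => a (sphere_pi t))).
  exact: reparam_continuous.
exact: (comp_continuous (@sphere_pi_continuous R _) (@bmap_continuous _ _ a)).
Qed.

Lemma reparam_bmap_boundary a phi (t : cube R n.+1) (i : 'I_n.+1) :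
  (if i == ord0 then (phi (set_val t 0 ord0) <= 0) || (1 <= phi (set_val t 0 ord0))
   else (set_val t 0 i == 0) || (set_val t 0 i == 1)) ->
  a (sphere_pi (reparam phi t)) = point.
Proof.
by move=> h; rewrite (sphere_pi_boundary (reparam_boundary h)) bmap_point.
Qed.

Lemma concat_cube_continuous a b : continuous (concat_cube a b).
Proof.
have c2 : continuous (fun x : R => 2 * x).
  by move=> t; apply: cvgM; [exact: cvg_cst|exact: cvg_id].
have c21 : continuous (fun x : R => 2 * x - 1).
  by move=> t; apply: cvgB; [exact: c2|exact: cvg_cst].
pose p (t : cube R n.+1) : R := set_val t 0 ord0.
have cp : continuous p by exact: cube_coord_continuous.
apply: (@paste_continuous _ _ (p @^-1` [set x | x <= 2^-1])
    (p @^-1` [set x | 2^-1 <= x]) _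
    (fun t => a (sphere_pi (reparam (fun x => 2 * x) t)))
    (fun t => b (sphere_pi (reparam (fun x => 2 * x - 1) t)))).
- by apply: closed_comp; [move=> ? _; exact: cp|exact: closed_le].
- by apply: closed_comp; [move=> ? _; exact: cp|exact: closed_ge].
- by move=> t /=; case: (leP (p t) 2^-1) => [|/ltW]; [left|right].
- exact: reparam_bmap_continuous.
- exact: reparam_bmap_continuous.
- by move=> t /=; rewrite /concat_cube /p => ->.
- move=> t /=; rewrite /concat_cube /p => hp; case: ifPn => // ph.
  have pE : set_val t 0 ord0 = 2^-1 :> R by apply/eqP; rewrite eq_le ph hp.
  by rewrite !(@reparam_bmap_boundary _ _ _ ord0)//= pE mulfV// ?subrr lexx ?orbT.
Qed.

Lemma concat_cube_boundary a b t : cube_boundary t -> concat_cube a b t = point.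
Proof.
move=> /existsP[i]; have [->|i0] := eqVneq i ord0; last first.
  move=> h; rewrite /concat_cube.
  by case: ifP => _; apply: (@reparam_bmap_boundary _ _ _ i); rewrite (negbTE i0).
rewrite /concat_cube => /orP[/eqP t0|/eqP t1].
  rewrite t0 invr_ge0 ler0n; apply: (@reparam_bmap_boundary _ _ _ ord0).
  by rewrite eqxx t0 mulr0 lexx.
rewrite t1 ifF; last by apply/negbTE; rewrite -ltNge invf_lt1 ?ltr1n.
apply: (@reparam_bmap_boundary _ _ _ ord0).
by rewrite eqxx t1 mulr1 -[2]/(1 + 1) addrK lexx orbT.
Qed.

Definition concat a b : bmap (sphere R n.+1) X :=
  sphere_bmap (@concat_cube_continuous a b) (@concat_cube_boundary a b).

Definition reverse_cube a (t : cube R n.+1) : X :=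
  a (sphere_pi (reparam (fun x => 1 - x) t)).

Lemma reverse_cube_continuous a : continuous (reverse_cube a).
Proof.
apply: reparam_bmap_continuous => t.
by apply: cvgB; [exact: cvg_cst|exact: cvg_id].
Qed.

Lemma reverse_cube_boundary a t : cube_boundary t -> reverse_cube a t = point.
Proof.
move=> /existsP[i h]; apply: (@reparam_bmap_boundary _ _ _ i).
case: ifP h => [/eqP->|//] /orP[/eqP->|/eqP->]; last by rewrite subrr lexx.
by rewrite subr0 lexx orbT.
Qed.

Definition reverse a : bmap (sphere R n.+1) X :=
  sphere_bmap (@reverse_cube_continuous a) (@reverse_cube_boundary a).

(** [baseGroupType] carries the operations without the group axioms. *)
HB.instance Definition _ := hasMul.Build homotopy_group
  (fun u v => hclass (concat (repr u) (repr v))).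
HB.instance Definition _ := hasOne.Build homotopy_group (hclass (bmap_cst _ _)).
HB.instance Definition _ := hasInv.Build homotopy_group
  (fun u => hclass (reverse (repr u))).

End homotopy_group.
Section functoriality.
Context (R : realType).

Definition pi_map n (X Y : ptopologicalType) (f : bmap X Y)
    (u : homotopy_group R n X) : homotopy_group R n Y :=
  hclass (bmap_comp f (repr u)).

(** Degree [n + 1]. The conditions on [F] say that it extends the map
    [(a | id)] from the wedge of the sphere and [B]. *)
Definition gottlieb n (B : ptopologicalType) : set (homotopy_group R n B) :=
  [set u | exists2 a : bmap (sphere R n.+1) B, u = hclass a &
     exists F : sphere R n.+1 * B -> B,
       [/\ continuous F, forall s, F (s, point) = a s &
           forall b, F (point, b) = b]].

End functoriality.
Arguments gottlieb : clear implicits.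

Section cw_complex.
Context (R : realType).

Definition path_connected (X : topologicalType) : Prop :=
  forall x y : X, exists c : I01 R -> X,
    [/\ continuous c, c I0 = x & c I1 = y].

Definition simply_connected (X : ptopologicalType) : Prop :=
  path_connected X /\ forall u : homotopy_group R 0 X, u = 1%g.

Definition disc n : set 'rV[R]_n := [set t | \sum_i t 0 i ^+ 2 <= 1].
Definition open_disc n : set 'rV[R]_n := [set t | \sum_i t 0 i ^+ 2 < 1].
Definition disc_boundary n : set 'rV[R]_n := [set t | \sum_i t 0 i ^+ 2 = 1].

(** Only the values of [char_map] on the closed disc matter. *)
Record cw_structure (X : topologicalType) := CWStructure {
  cell : Type ;
  cell_dim : cell -> nat ;
  char_map : forall j, 'rV[R]_(cell_dim j) -> X ;
  open_cell := fun j => @char_map j @` @open_disc (cell_dim j) ;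
  char_map_continuous : forall j,
    {within @disc (cell_dim j), continuous (@char_map j)} ;
  char_map_inj : forall j (s t : 'rV[R]_(cell_dim j)), open_disc s -> open_disc t ->
    char_map s = char_map t -> s = t ;
  open_cell_cover : forall x, exists j, open_cell j x ;
  open_cell_disjoint : forall i j x, open_cell i x -> open_cell j x -> i = j ;
  closure_finite : forall j, exists K : set cell,
    [/\ finite_set K, forall k, K k -> (cell_dim k < cell_dim j)%N &
        @char_map j @` @disc_boundary (cell_dim j)
          `<=` \bigcup_(k in K) open_cell k] ;
  weak_topology : forall A : set X,
    (forall j, closed (@disc (cell_dim j) `&` @char_map j @^-1` A)) -> closed A }.

Definition cw_complex (X : topologicalType) : Prop :=
  hausdorff_space X /\ inhabited (cw_structure X).

End cw_complex.

Section singular_homology.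
Context (R : realType).

Definition simplex n : Type :=
  set_type [set t : 'rV[R]_n.+1 | (forall i, 0 <= t 0 i) /\ \sum_i t 0 i = 1].
HB.instance Definition _ n := Topological.on (simplex n).

(** The [i]-th face inclusion inserts a zero at position [i]. *)
Definition face_row n (i : 'I_n.+2) (t : simplex n) : 'rV[R]_n.+2 :=
  \row_j if unlift i j is Some k then set_val t 0 k else 0.

Lemma face_subproof n (i : 'I_n.+2) (t : simplex n) :
  (forall j, 0 <= face_row i t 0 j) /\ \sum_j face_row i t 0 j = 1.
Proof.
have [t0 t1] : (forall i, 0 <= set_val t 0 i) /\ \sum_i set_val t 0 i = 1 :> R.
  exact: (set_mem (valP t)).
split=> [j|]; first by rewrite mxE; case: unlift.
rewrite (bigD1_ord i)//= mxE unlift_none add0r -[RHS]t1.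
by apply: eq_bigr => k _; rewrite mxE liftK.
Qed.

Definition face n (i : 'I_n.+2) (t : simplex n) : simplex n.+1 :=
  exist (fun t => t \in [set t : 'rV[R]_n.+2 |
                          (forall i, 0 <= t 0 i) /\ \sum_i t 0 i = 1]) _
    (mem_set (face_subproof i t)).

Lemma face_continuous n (i : 'I_n.+2) : continuous (@face n i).
Proof.
apply: to_set_type_continuous.
have -> : set_val \o @face n i = face_row i.
  by apply/funext => t; rewrite /comp set_valE.
apply: mx_continuous => h j.
have -> : (fun t => face_row i t h j) =
    if unlift i j is Some k then fun t : simplex n => set_val t 0 k else fun=> 0.
  by apply/funext => t; rewrite mxE; case: unlift.
case: unlift => [k|]; last exact: cst_continuous.
apply: (comp_continuous (g := fun t : 'rV[R]_n.+1 => t 0 k)).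
  exact: set_val_continuous.
exact: coord_continuous.
Qed.

HB.instance Definition _ n (i : 'I_n.+2) :=
  isContinuous.Build _ _ (@face n i) (@face_continuous n i).

Context (X : topologicalType).

Definition singular_simplex n : Type := continuousType (simplex n) X.
HB.instance Definition _ n := Choice.on (singular_simplex n).

Definition chain n : Type := {freeg (singular_simplex n) / rat}.
HB.instance Definition _ n := GRing.Lmodule.on (chain n).

Definition singular_face n (i : 'I_n.+2) (s : singular_simplex n.+1) :
  singular_simplex n := s \o @face n i.

Definition boundary n : chain n.+1 -> chain n :=
  fglift (fun s => \sum_(i < n.+2) (-1) ^+ i *: (<< singular_face i s >> : chain n)).

Definition cycle n : set (chain n) :=
  match n with
  | 0 => setT
  | m.+1 => [set c | boundary c = 0]
  end.

(** Every rational homology group, cycles modulo boundaries, is spanned by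
    finitely many classes. *)
Definition rational_finite_type : Prop := forall n, exists k (z : 'I_k -> chain n),
  (forall i, cycle (z i)) /\
  forall c, cycle c -> exists (q : 'I_k -> rat) (b : chain n.+1),
    c = \sum_i q i *: z i + boundary b.

End singular_homology.

Section rational_dimension.
Context (R : realType) (V : baseGroupType).
Local Open Scope group_scope.

Definition zpow (v : V) (z : int) : V :=
  match z with Posz m => v ^+ m | Negz m => v ^- m.+1 end.

(** [w] is the product of the scalar [q] and [v] in multiplicative notation:
    when [V] is a uniquely divisible abelian group, i.e. a rational vector
    space, there is exactly one such [w]. *)
Definition is_qscale (q : rat) (v w : V) : Prop :=
  w ^+ `|denq q|%N = zpow v (numq q).

(** Linear independence over the rationals of the images of the [v i] in the
    quotient of [V] by [W]. *)
Definition qfree_mod (W : set V) k (v : 'I_k -> V) : Prop :=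
  forall (q : 'I_k -> rat) (w : 'I_k -> V),
    (forall i, is_qscale (q i) (v i) (w i)) -> W (\prod_i w i) ->
    forall i, q i = 0%R.

(** The dimension over the rationals of the image of [A] in the quotient of [V]
    by [W], when [V] is a rational vector space with subspaces [A] and [W]. *)
Definition qdim (A W : set V) : \bar R :=
  ereal_sup [set k%:R%:E | k in
    [set k | exists v : 'I_k -> V, (forall i, A (v i)) /\ qfree_mod W v]].

End rational_dimension.

Section rationalization.
Context (R : realType).

(** The last condition, unique divisibility, says that the homotopy groups are
    rational vector spaces. *)
Definition rational_space (X : ptopologicalType) : Prop :=
  [/\ simply_connected R X, cw_complex R X &
      forall n k, (0 < k)%N ->
        bijective (fun u : homotopy_group R n X => (u ^+ k)%g)].

(** [l] exhibits [XQ] as the rationalization of [X]: the homotopy groups of [XQ]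
    are rational vector spaces, and the last two conditions say that the map from
    the tensor product of the rationals with the homotopy groups of [X]
    that [l] induces is surjective and injective. *)
Definition rationalization (X XQ : ptopologicalType) (l : bmap X XQ) : Prop :=
  [/\ rational_space XQ,
      forall n (v : homotopy_group R n XQ), exists2 k, (0 < k)%N &
        exists u : homotopy_group R n X, (v ^+ k)%g = pi_map l u &
      forall n (u : homotopy_group R n X), pi_map l u = 1%g ->
        exists2 k, (0 < k)%N & (u ^+ k)%g = 1%g].

Definition rationalization_map (X Y XQ YQ : ptopologicalType)
    (lX : bmap X XQ) (lY : bmap Y YQ) (f : bmap X Y) (fQ : bmap XQ YQ) : Prop :=
  homotopic R (bmap_comp fQ lX) (bmap_comp lY f).

End rationalization.

Section invariants.
Context (R : realType).
Local Open Scope ereal_scope.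

(** [B] is meant to be a rational space. Index [n] is degree [n + 1], so that the
    sums range over all positive degrees; the dimension of a direct sum is the sum
    of the dimensions. *)
Definition dimG (B : ptopologicalType) : \bar R :=
  \sum_(0 <= n <oo) qdim R (gottlieb R n B) [set 1%g].

(** This is the invariant [o(h)] of a map [h] when [f] is a rationalization of
    [h]. *)
Definition dimO (E B : ptopologicalType) (f : bmap E B) : \bar R :=
  \sum_(0 <= n <oo) qdim R (pi_map f @` gottlieb R n E) (gottlieb R n B).

End invariants.

(* Main.v *)
Require Import Defs.
From HB Require Import structures.
From mathcomp Require Import all_boot all_order all_algebra.
From mathcomp Require Import all_classical all_reals all_analysis.
From mathcomp Require Import finmap.
From mathcomp Require Import ring lra.

(** In each degree, let [A] be the image in [pi_n(YQ)] of the Gottlieb group of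
    [XQ], and let [phi = pi_n(fQ)], so that [pi_n(fgQ)] is [phi] after [pi_n(gQ)].
    The span of [phi A] modulo [G_n(ZQ)] is an extension of a quotient of [A] modulo
    [G_n(YQ)] by a part coming from [phi (A /\ G_n(YQ))], whence the inequality,
    degree by degree. This linear algebra is carried out with integer coefficients,
    for which the Gottlieb groups need only be known to be closed under products.

    That [pi_n(fgQ)] is the composite holds on the image of [pi_n(X)], and then
    everywhere because roots are unique in [pi_n(ZQ)]. *)

Set Implicit Arguments.
Unset Strict Implicit.
Unset Printing Implicit Defensive.

Import Order.TTheory GRing.Theory Num.Theory.
Import numFieldNormedType.Exports.

Local Open Scope classical_set_scope.
Local Open Scope ring_scope.

(** * Independence over the integers and rational dimension *)

(** [baseGroupType] carries no axioms, so the laws are supplied as a proof; [zmod_of] records that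
    proof in the type, where it selects the [zmodType] structure. *)
Record abelian_laws (V : baseGroupType) : Prop := AbelianLaws {
  abelian_mulA : associative (fun x y : V => x * y)%g ;
  abelian_mulC : commutative (fun x y : V => x * y)%g ;
  abelian_mul1 : left_id (1%g : V) (fun x y : V => x * y)%g ;
  abelian_mulV : left_inverse (1%g : V) (fun x : V => x^-1)%g (fun x y : V => x * y)%g }.

Definition zmod_of (V : baseGroupType) (h : abelian_laws V) : Type := V.
HB.instance Definition _ V (h : abelian_laws V) := gen_eqMixin (zmod_of h).
HB.instance Definition _ V (h : abelian_laws V) := gen_choiceMixin (zmod_of h).
HB.instance Definition _ V (h : abelian_laws V) := GRing.isZmodule.Build (zmod_of h)
  (abelian_mulA h) (abelian_mulC h) (abelian_mul1 h) (abelian_mulV h).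

(** With integer coefficients, independence modulo [G] makes sense for any set [G] and requires no
    division in [V]. *)
Definition zfree_mod (V : zmodType) (G : set V) k (v : 'I_k -> V) : Prop :=
  forall c : 'I_k -> int, G (\sum_i v i *~ c i) -> forall i, c i = 0.

Section zfree.
Context (V : zmodType) (G : set V) (k : nat) (v : 'I_k -> V).

(** A subfamily is encoded by the support of its coefficients, so that all relations keep the index
    type ['I_k]. *)
Definition zfree_on (D : {set 'I_k}) : Prop :=
  forall c : 'I_k -> int, (forall i, i \notin D -> c i = 0) ->
    G (\sum_i v i *~ c i) -> forall i, c i = 0.

Lemma zfree_on_enum (D : {set 'I_k}) :
  zfree_on D -> zfree_mod G (fun l : 'I_#|D| => v (enum_val l)).
Proof.
(* This extends [e] by zero: the sum has one term when [i] is in [D] and none otherwise. *)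
move=> free e Ge l; pose c i := \sum_(l : 'I_#|D| | enum_val l == i) e l.
have -> : e l = c (enum_val l).
  by rewrite /c (big_pred1 l) // => m; rewrite (inj_eq enum_val_inj).
apply: free => [i iD|].
  rewrite /c big_pred0 // => m; apply/negbTE/eqP => mi.
  by move: iD; rewrite -mi enum_valP.
rewrite [X in G X](_ : _ = \sum_l v (enum_val l) *~ e l) //.
rewrite [RHS](partition_big (fun l => enum_val l) xpredT) //=.
apply: eq_bigr => i _; rewrite /c mulrz_sumr.
by apply: eq_bigr => m /eqP ->.
Qed.

(** Take [D] maximal for inclusion. For [j] outside [D], adding [j] creates a nontrivial relation,
    which must involve [j] because [D] is free; it is row [j] of [M]. Outside [D], the matrix [M] is
    thus diagonal with nonzero diagonal entries. *)
Lemma zfree_on_max : exists2 D : {set 'I_k}, zfree_on D &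
  exists M : 'I_k -> 'I_k -> int, forall j, j \notin D ->
    [/\ G (\sum_i v i *~ M j i), M j j != 0 &
        forall i, i \notin D -> i != j -> M j i = 0].
Proof.
have /ex_maxset[D /maxsetP[/asboolP freeD maxD]] :
    exists D : {set 'I_k}, `[< zfree_on D >].
  by exists finset.set0; apply/asboolP => c c0 _ i; rewrite c0 ?inE.
exists D => //.
suff /choice[M hM] : forall j, exists m : 'I_k -> int, j \notin D ->
    [/\ G (\sum_i v i *~ m i), m j != 0 &
        forall i, i \notin D -> i != j -> m i = 0] by exists M.
move=> j; have [jD|jD] := boolP (j \in D); first by exists (fun=> 0).
have nfree : ~ zfree_on (j |: D).
  move=> fr; have := maxD (j |: D) (asboolT fr) (finset.subsetUr _ _).
  by move=> E; move: jD; rewrite -E setU11.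
apply: contrapT => nex; apply: nfree => c csupp Gc.
have [cj0|cj0] := eqVneq (c j) 0.
  apply: freeD => // i iD; have [->//|ij] := eqVneq i j.
  by apply: csupp; rewrite in_setU1 negb_or ij.
case: nex; exists c => _; split => // i iD ij.
by apply: csupp; rewrite in_setU1 negb_or ij.
Qed.

End zfree.

Section qfree.
Context (V : baseGroupType) (h : abelian_laws V) (G : set V).
Hypothesis Gmul : forall x y, G x -> G y -> G (x * y)%g.

Lemma zpowE (v : zmod_of h) z : zpow (v : V) z = v *~ z :> zmod_of h.
Proof. by case: z. Qed.

(** Integers are rationals with denominator 1; conversely, multiplying a rational relation by the
    product of all denominators makes it integral. *)
Lemma qfree_zfree_mod k (v : 'I_k -> V) :
  qfree_mod G v <-> zfree_mod (G : set (zmod_of h)) v.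
Proof.
split=> [free c Gc i|free q w qw Gw i].
  apply/eqP; rewrite -(intr_eq0 rat); apply/eqP.
  apply: (free (fun i => (c i)%:~R) (fun i => (v i : zmod_of h) *~ c i)) => // j.
  by rewrite /is_qscale numq_int denq_int zpowE.
pose d i := `|denq (q i)|%N; pose N i := (\prod_(j < k | j != i) d j)%N.
have d0 j : (0 < d j)%N by rewrite absz_gt0 denq_neq0.
have dN j : (\prod_j d j = d j * N j)%N by rewrite (bigD1 j).
(* Closure under products yields closure under positive multiples, which is enough because the
   product of the denominators is positive. *)
have GN n (x : zmod_of h) : G x -> G (x *+ n.+1).
  by move=> Gx; elim: n => // n IH; rewrite mulrS; exact: Gmul.
have : G (\sum_j (v j : zmod_of h) *~ (numq (q j) * (N j)%:Z)).
  have -> : \sum_j (v j : zmod_of h) *~ (numq (q j) * (N j)%:Z) =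
      (\sum_j (w j : zmod_of h)) *+ (\prod_j d j)%N.
    rewrite -sumrMnl; apply: eq_bigr => j _.
    rewrite (dN j) mulrnA mulrzA; congr (_ *+ _).
    by rewrite -zpowE -(qw j).
  have : (0 < \prod_j d j)%N by exact: prodn_gt0.
  by case: (\prod_j d j)%N => // n _; exact: GN.
move=> /free/(_ i)/eqP; rewrite mulf_eq0 numq_eq0 => /orP[/eqP//|].
by rewrite eqz_nat gtn_eqF// prodn_cond_gt0.
Qed.

End qfree.

Section qdim.
Context (R : realType).

Lemma qdim_ge (V : baseGroupType) (A G : set V) k (v : 'I_k -> V) :
  (forall i, A (v i)) -> qfree_mod G v -> (k%:R%:E <= qdim R A G)%E.
Proof. by move=> Av free; apply: ereal_sup_ubound; exists k => //; exists v. Qed.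

Lemma qdim_ge0 (V : baseGroupType) (A G : set V) : (0 <= qdim R A G)%E.
Proof.
by apply: (@qdim_ge _ _ _ 0 (fun=> 1%g)) => [[]|q w _ _ []].
Qed.

(* Given elements [v i] of [A] whose images are independent modulo [H], a maximal
   subfamily independent modulo [G] counts towards [qdim A G], and each of the
   other [v i] has a nonzero multiple which becomes an element of [G] after adding
   a combination of the subfamily; these elements count towards the other term. *)
Lemma qdim_image_le (V W : baseGroupType) (hV : abelian_laws V)
    (hW : abelian_laws W) (f : V -> W) (A G : set V) (H : set W) :
  (forall x y, f (x * y)%g = (f x * f y)%g) ->
  (forall x y, G x -> G y -> G (x * y)%g) ->
  (forall x y, H x -> H y -> H (x * y)%g) ->
  (qdim R (f @` A) H <= qdim R (f @` G) H + qdim R A G)%E.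
Proof.
move=> fM GM HM; apply: ge_ereal_sup => _ [k [w [fAw free] <-]].
have /choice[v hv] i : exists x, A x /\ f x = w i.
  by have [x Ax xw] := fAw i; exists x.
pose vz : 'I_k -> zmod_of hV := v.
have /(qfree_zfree_mod hW HM) wfree := free.
pose fz : zmod_of hV -> zmod_of hW := f.
have fzB : {morph fz : x y / x - y}.
  move=> x y; apply: (addIr (fz y)); rewrite subrK.
  by rewrite -[LHS]fM [X in f X](_ : _ = (x - y + y))// subrK.
pose fza : {additive zmod_of hV -> zmod_of hW} :=
  HB.pack fz (GRing.isZmodMorphism.Build _ _ fz fzB).
have [D Dfree [M hM]] := zfree_on_max (G : set (zmod_of hV)) vz.
pose b j : zmod_of hV := (\sum_i vz i *~ M j i).
have bfree : zfree_on (H : set (zmod_of hW)) (fun j => fza (b j)) (~: D).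
  move=> c csupp Hc.
  (* Expanding each [b j] turns the relation [c] into one among the [w i], which are independent.
     For [i] outside [D] the sum reduces to its diagonal term, and [M i i] is nonzero. *)
  have : forall i, (\sum_j M j i * c j) = 0.
    apply: wfree; rewrite [X in H X](_ : _ = (\sum_j fza (b j) *~ c j))//.
    under eq_bigr => i _ do rewrite mulrz_sumr.
    rewrite exchange_big; apply: eq_bigr => j _.
    rewrite raddf_sum mulrz_suml; apply: eq_bigr => i _.
    by rewrite mulrzA raddfMz /=; congr (_ *~ _ *~ _); rewrite -(hv i).2.
  move=> cM i; have [iD|iD] := boolP (i \in D); first by apply: csupp; rewrite inE iD.
  have := cM i; rewrite (bigD1 i)//= big1 ?addr0.
    by move=> /eqP; rewrite mulf_eq0; have [_ /negbTE -> _ /eqP] := hM i iD.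
  move=> j ji; have [jD|jD] := boolP (j \in D).
    by rewrite csupp ?mulr0// inE jD.
  by have [_ _ ->] := hM j jD; rewrite ?mul0r// eq_sym.
have -> : k%:R%:E = (#|~: D|%:R%:E + #|D|%:R%:E)%E :> \bar R.
  by rewrite -EFinD -natrD addnC cardsC card_ord.
apply: leeD.
  apply: (@qdim_ge _ _ _ _ (fun l : 'I_#|~: D| => fza (b (enum_val l)))).
    move=> l; exists (b (enum_val l)) => //.
    by have := enum_valP l; rewrite inE => /hM[].
  by apply/(qfree_zfree_mod hW HM); exact: zfree_on_enum bfree.
apply: (@qdim_ge _ _ _ _ (fun l : 'I_#|D| => v (enum_val l))).
  by move=> l; have [] := hv (enum_val l).
by apply/(qfree_zfree_mod hV GM); exact: zfree_on_enum Dfree.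
Qed.

End qdim.

(** * Cubes and spheres *)

(** The tube lemma: the open sets over which a single neighbourhood of [b] works cover [K]; finitely
    many suffice, and their neighbourhoods of [b] are intersected. *)
Lemma tube (T : ptopologicalType) (B : topologicalType) (K : set T) (b : B)
    (W : T -> B -> Prop) :
  compact K -> (forall x, K x -> \forall x' \near x & b' \near b, W x' b') ->
  exists2 U : set T, open U /\ K `<=` U & \forall b' \near b, forall x, U x -> W x b'.
Proof.
rewrite compact_cover => cK KW.
pose D := [set U : set T | open U /\ \forall b' \near b, forall x, U x -> W x b'].
have [|x Kx|D' D'D KD'] := cK _ D id; first by move=> U [].
  have [[U V] /= [xU bV] UVW] := KW x Kx.
  exists U^°; last exact: xU.
  split; first exact: open_interior.
  by apply: filterS bV => b' Vb' x' /interior_subset Ux'; exact: (UVW (x', b')).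
exists (cover [set` D'] id).
  by split=> //; apply: bigcup_open => U /D'D/set_mem[].
have : \forall b' \near b, forall U : set T, U \in D' -> forall x, U x -> W x b'.
  have : nbhs b (\bigcap_(U in [set` D']) [set b' | forall x, U x -> W x b']).
    by apply: filter_bigI => U /D'D/set_mem[].
  by apply: filterS => b' h U UD' x Ux; exact: h UD' x Ux.
by apply: filterS => b' h x [U /= UD' Ux]; exact: (h U UD').
Qed.

Lemma if_continuous (R : realType) (T U : topologicalType) (p : T -> R) (c : R)
    (f g : T -> U) :
  continuous p -> continuous f -> continuous g ->
  (forall x, p x = c -> f x = g x) ->
  continuous (fun x => if p x <= c then f x else g x).
Proof.
move=> cp cf cg fg.
apply: (@paste_continuous _ _ (p @^-1` [set x | x <= c]) (p @^-1` [set x | c <= x])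
  _ f g) => //.
- by apply: closed_comp; [move=> ? _; exact: cp|exact: closed_le].
- by apply: closed_comp; [move=> ? _; exact: cp|exact: closed_ge].
- by move=> x /=; case: (leP (p x) c) => [|/ltW]; [left|right].
- by move=> x /= ->.
- by move=> x /= cx; case: ifPn => // xc; apply: fg; apply/eqP; rewrite eq_le xc.
Qed.

Section cube.
Context (R : realType).

Definition put_row n (i : 'I_n) (t : cube R n) (x : R) : 'rV[R]_n :=
  \row_j if j == i then set_val (clamp x) else set_val t 0 j.

Lemma put_subproof n (i : 'I_n) (t : cube R n) x j : 0 <= put_row i t x 0 j <= 1.
Proof.
rewrite mxE; case: ifP => _; first exact: I01_itv.
exact: (set_mem (valP t)).
Qed.

(** The point [t] with its coordinate [i] replaced by [x], clamped to [0, 1]. *)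
Definition put n (i : 'I_n) (t : cube R n) (x : R) : cube R n :=
  exist (fun t => t \in [set t : 'rV[R]_n | forall j, 0 <= t 0 j <= 1]) _
    (mem_set (put_subproof i t x)).

Definition cube_coord n (t : cube R n) (i : 'I_n) : R := set_val t 0 i.

Lemma coord_itv n (t : cube R n) i : 0 <= cube_coord t i <= 1.
Proof. exact: (set_mem (valP t)). Qed.

Lemma coord_put n (i j : 'I_n) t x :
  cube_coord (put i t x) j = if j == i then set_val (clamp x) else cube_coord t j.
Proof. by rewrite /cube_coord set_valE /= mxE. Qed.

Lemma coord_inj n (s t : cube R n) : cube_coord s =1 cube_coord t -> s = t.
Proof. by move=> st; apply/val_inj => /=; apply/rowP => i; exact: st. Qed.

Lemma put_put n (i : 'I_n) t x y : put i (put i t x) y = put i t y.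
Proof. by apply: coord_inj => j; rewrite !coord_put; case: eqP. Qed.

Lemma putC n (i j : 'I_n) t x y :
  i != j -> put i (put j t x) y = put j (put i t y) x.
Proof.
move=> ij; apply: coord_inj => k; rewrite !coord_put.
by case: (eqVneq k i) => // ->; rewrite (negbTE ij).
Qed.

Lemma put_coord n (i : 'I_n) t : put i t (cube_coord t i) = t.
Proof.
apply: coord_inj => j; rewrite coord_put; case: eqP => // ->.
by rewrite clampE// coord_itv.
Qed.

(** Reduces the changes of variable in [concat] and [reverse] to [put], which acts on any
    coordinate. *)
Lemma reparam_put n phi (t : cube R n.+1) :
  reparam phi t = put ord0 t (phi (cube_coord t ord0)).
Proof. by apply: coord_inj => j; rewrite coord_put /cube_coord set_valE /= mxE. Qed.

Lemma put_continuous n (i : 'I_n) (T : topologicalType) (f : T -> cube R n)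
    (g : T -> R) :
  continuous f -> continuous g -> continuous (fun x => put i (f x) (g x)).
Proof.
move=> cf cg; apply: to_set_type_continuous.
have -> : set_val \o (fun x => put i (f x) (g x)) = fun x => put_row i (f x) (g x).
  by apply/funext => t; rewrite /comp set_valE.
apply: mx_continuous => h j.
have -> : (fun x => put_row i (f x) (g x) h j) =
    if j == i then fun x => set_val (clamp (g x)) else fun x => cube_coord (f x) j.
  by apply/funext => t; rewrite mxE; case: ifP.
case: ifP => _; last exact: (comp_continuous cf (@cube_coord_continuous R n j)).
apply: (comp_continuous cg (g := fun x => set_val (clamp x))).
exact: (comp_continuous (@clamp_continuous R) (@I01_val_continuous R)).
Qed.

Lemma boundaryP n (t : cube R n) :
  reflect (exists i, cube_coord t i = 0 \/ cube_coord t i = 1) (cube_boundary t).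
Proof.
apply: (iffP existsP) => [[i /orP[]/eqP ti]|[i [] ti]]; exists i; rewrite -/(cube_coord t i).
- by left.
- by right.
- by rewrite ti eqxx.
- by rewrite ti eqxx orbT.
Qed.

(** These are the values that [clamp] sends to an end of the interval. *)
Definition outer (x : R) : bool := (x <= 0) || (1 <= x).

Lemma put_outer n (i : 'I_n) t x : outer x -> cube_boundary (put i t x).
Proof.
move=> /orP[x0|x1]; apply/boundaryP; exists i; rewrite coord_put eqxx.
  by left; rewrite clamp_le0// I0E.
by right; rewrite clamp_ge1// I1E.
Qed.

Lemma put_boundary n (i : 'I_n) (t : cube R n) x :
  (cube_coord t i = 0 -> outer x) -> (cube_coord t i = 1 -> outer x) ->
  cube_boundary t -> cube_boundary (put i t x).
Proof.
move=> h0 h1 /boundaryP[j]; have [->[/h0|/h1]|ji tj] := eqVneq j i.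
- exact: put_outer.
- exact: put_outer.
by apply/boundaryP; exists j; rewrite coord_put (negbTE ji).
Qed.

(** The cube is the image of a compact box of row vectors under coordinatewise clamping. *)
Lemma cube_compact n : compact [set: cube R n].
Proof.
pose box := [set v : 'rV[R]_n | forall i, `[0, 1]%classic (v ord0 i)].
have cbox : compact box.
  by rewrite /box; apply: (@rV_compact R n (fun=> `[0, 1]%classic)) => _;
    exact: segment_compact.
pose F (v : 'rV[R]_n) : 'rV[R]_n := \row_i set_val (clamp (v 0 i)).
have Fsub v i : 0 <= F v 0 i <= 1 by rewrite mxE I01_itv.
pose G (v : 'rV[R]_n) : cube R n :=
  exist (fun t => t \in [set t : 'rV[R]_n | forall j, 0 <= t 0 j <= 1]) _
    (mem_set (Fsub v)).
have -> : [set: cube R n] = G @` box.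
  apply/esym/seteqP; split=> // t _; exists (set_val t).
    by move=> i; rewrite /= in_itv /=; exact: coord_itv.
  apply: coord_inj => i; rewrite /cube_coord [in LHS]set_valE /= mxE clampE//.
  exact: coord_itv.
apply: continuous_compact cbox; apply: continuous_subspaceT.
apply: to_set_type_continuous.
have -> : set_val \o G = F by apply/funext => v; rewrite /comp set_valE.
apply: mx_continuous => i j.
have -> : (fun v => F v i j) = fun v => set_val (clamp (v 0 j)).
  by apply/funext => v; rewrite mxE.
apply: (comp_continuous (f := fun v : 'rV[R]_n => v 0 j)
   (g := fun x => set_val (clamp x))); first exact: coord_continuous.
exact: (comp_continuous (@clamp_continuous R) (@I01_val_continuous R)).
Qed.

Lemma closed_boundary n : closed [set t : cube R n | cube_boundary t].
Proof.
rewrite (_ : mkset _ = ~` [set t | ~~ cube_boundary t]); last first.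
  by apply/seteqP; split=> t /=; [move=> ->|move=> /negP/negPn].
apply: open_closedC; rewrite openE => t /= tb.
have : \forall s \near t, forall i, cube_coord s i != 0 /\ cube_coord s i != 1.
  apply: (@filter_forall _ _
    (fun i s => cube_coord s i != 0 /\ cube_coord s i != 1) (nbhs t)) => i.
  have ci : {for t, continuous (fun s : cube R n => cube_coord s i)}.
    exact: cube_coord_continuous.
  have ti : cube_coord t i != 0 /\ cube_coord t i != 1.
    by split; apply/eqP => ti; move/boundaryP: tb; case; exists i; [left|right].
  have near_neq y : cube_coord t i != y -> \forall s \near t, cube_coord s i != y.
    by move=> ty; apply: (ci [set x | x != y]); apply: open_nbhs_nbhs; split=> //;
      exact: open_neq.
  have [ti0 ti1] := ti.
  exact: filterI (near_neq _ ti0) (near_neq _ ti1).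
apply: filterS => s hs; apply/boundaryP => -[i [] /eqP si];
  by have [/negP + /negP +] := hs i; rewrite si.
Qed.

(* The quotient map from the cube is proper, so it remains a quotient map after
   taking the product with [B]. *)
Lemma sphere_prod_continuous n (B Y : topologicalType) (H : cube R n * B -> Y) :
  continuous H ->
  (forall s t b, cube_boundary s -> cube_boundary t -> H (s, b) = H (t, b)) ->
  continuous (fun p : sphere R n * B => H (repr p.1, p.2)).
Proof.
move=> cH Hb [s0 b0] O /= HO.
have Hpi t b : H (repr (sphere_pi t), b) = H (t, b).
  have : sphere_pi (repr (sphere_pi t)) = sphere_pi t by rewrite /sphere_pi reprK.
  by move=> /sphere_piP/orP[/eqP ->//|/andP[? ?]]; exact: Hb.
(* [K] is the fibre of the quotient map over [s0]: the whole boundary over the base point, a single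
   point elsewhere. *)
pose K := [set t : cube R n | if cube_boundary (repr s0) then cube_boundary t
                              else t == repr s0].
have K0 t : K t -> H (t, b0) = H (repr s0, b0).
  by rewrite /K /=; case: ifP => [? ?|_ /eqP ->//]; exact: Hb.
have cK : compact K.
  rewrite /K; case: (cube_boundary (repr s0)).
    by apply: subclosed_compact (@closed_boundary n) (@cube_compact n) _.
  rewrite (_ : mkset _ = [set repr s0]); first exact: compact_set1.
  by apply/seteqP; split=> t /= /eqP.
have [|U [oU KU] UO] := @tube (cube R n) B K b0 (fun t b => O (H (t, b))) cK.
  move=> t /K0 Ht; move: HO; rewrite -Ht => HO.
  have [[A1 A2] AB sub] := cH (t, b0) O HO.
  by exists (A1, A2) => // -[x b] /sub.
(* [U'] is a saturated open set around the fibre: over the base point [U] already contains the whole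
   boundary, and elsewhere the boundary is removed. *)
pose U' := [set t | U t /\ (cube_boundary (repr s0) \/ ~ cube_boundary t)].
have oU' : open U'.
  have [bs0|bs0] := pselect (cube_boundary (repr s0)).
    by rewrite (_ : U' = U)//; apply/seteqP; split=> [t []//|t Ut]; split=> //; left.
  rewrite (_ : U' = U `&` ~` [set t | cube_boundary t]); last first.
    apply/seteqP; split=> t [Ut]; first by case.
    by move=> bt; split=> //; right.
  by apply: openI => //; exact: closed_openC (@closed_boundary n).
have sat t t' : sphere_pi t = sphere_pi t' -> U' t -> U' t'.
  move=> /sphere_piP/orP[/eqP ->//|/andP[bt bt']] [Ut [bs0|//]].
  by split; [apply: KU; rewrite /K /= bs0|left].
exists ([set s : sphere R n | U' (repr s)], [set b | forall t, U t -> O (H (t, b))]).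
  split=> //=; apply: open_nbhs_nbhs; split.
    rewrite /open /= /quotient_topology.quotient_open.
    rewrite (_ : _ @^-1` _ = U')//; apply/seteqP; split=> t /=; apply: sat;
    by rewrite /sphere_pi reprK.
  split; first by apply: KU; rewrite /K /=; case: ifP.
  exact: EM.
by move=> [s b] /= [[Us _] /(_ _ Us)].
Qed.

End cube.

(** * Homotopy groups *)

Section sphere_homotopy.
Context (R : realType) (n : nat) (X : ptopologicalType).
Implicit Types (a b c : bmap (sphere R n.+1) X) (t : cube R n.+1).

Lemma repr_sphere_pi t : repr (sphere_pi t) = t \/
  cube_boundary (repr (sphere_pi t)) /\ cube_boundary t.
Proof.
have : sphere_pi (repr (sphere_pi t)) = sphere_pi t by rewrite /sphere_pi reprK.
by move=> /sphere_piP/orP[/eqP|/andP[]]; [left|right].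
Qed.

Lemma repr_sphere_point : cube_boundary (repr (point : sphere R n.+1)).
Proof.
have b0 : cube_boundary (cube0 R n.+1).
  by apply/boundaryP; exists ord0; left; rewrite /cube_coord set_valE /= mxE.
by rewrite sphere_pi_point; have [->|[]] := repr_sphere_pi (cube0 R n.+1).
Qed.

Lemma sphere_bmap_pi (f : cube R n.+1 -> X) (cf : continuous f)
    (f0 : forall t, cube_boundary t -> f t = point) t :
  sphere_bmap cf f0 (sphere_pi t) = f t.
Proof.
rewrite [LHS]/=; have [->|[? ?]] := repr_sphere_pi t; first by [].
by rewrite !f0.
Qed.

Lemma bmap_boundary a t : cube_boundary t -> a (sphere_pi t) = point.
Proof. by move=> /sphere_pi_boundary ->; exact: bmap_point. Qed.

Lemma bmap_outer a i t x : outer x -> a (sphere_pi (put i t x)) = point.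
Proof. by move=> x_out; rewrite bmap_boundary// put_outer. Qed.

Lemma bmap_pi_continuous a (T : topologicalType) (f : T -> cube R n.+1) :
  continuous f -> continuous (fun x => a (sphere_pi (f x))).
Proof.
move=> cf; apply: (comp_continuous (g := fun t => a (sphere_pi t))) => //.
exact: (comp_continuous (@sphere_pi_continuous R _) (@bmap_continuous _ _ a)).
Qed.

(** Homotopies are written in the coordinates of the cube and then descend to the sphere by
    [sphere_prod_continuous]. *)
Lemma cube_homotopic a b (H : I01 R * cube R n.+1 -> X) :
  continuous H -> (forall t, H (I0, t) = a (sphere_pi t)) ->
  (forall t, H (I1, t) = b (sphere_pi t)) ->
  (forall s t, cube_boundary t -> H (s, t) = point) -> homotopic R a b.
Proof.
move=> cH Ha Hb Hpt; exists (fun p => H (p.1, repr p.2)); split=> [|x|x|s] /=.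
(* The factors are swapped because [sphere_prod_continuous] has the sphere first. *)
- pose K (p : cube R n.+1 * I01 R) := H (p.2, p.1).
  have cK : continuous K.
    apply: (comp_continuous _ cH).
    by apply: pair_continuous; [exact: snd_continuous|exact: fst_continuous].
  apply: (comp_continuous (f := fun p : I01 R * sphere R n.+1 => (p.2, p.1))
    (g := fun p => K (repr p.1, p.2))).
    by apply: pair_continuous; [exact: snd_continuous|exact: fst_continuous].
  apply: sphere_prod_continuous => // s t u bs bt.
  by rewrite /K /= !Hpt.
- by rewrite Ha /sphere_pi reprK.
- by rewrite Hb /sphere_pi reprK.
- by rewrite Hpt// repr_sphere_point.
Qed.

(** Then the whole segment from [x] to [y] lies beyond one end, so a straight-line homotopy stays at
    the base point there. *)
Definition same_end (x y : R) : bool := (x <= 0) && (y <= 0) || (1 <= x) && (1 <= y).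

(* The straight-line homotopy between two changes of variable. *)
Lemma put_homotopic a b c i (phi psi : R -> R) :
  continuous phi -> continuous psi ->
  same_end (phi 0) (psi 0) -> same_end (phi 1) (psi 1) ->
  (forall t, a (sphere_pi t) = c (sphere_pi (put i t (phi (cube_coord t i))))) ->
  (forall t, b (sphere_pi t) = c (sphere_pi (put i t (psi (cube_coord t i))))) ->
  homotopic R a b.
Proof.
move=> cphi cpsi end0 end1 ha hb.
pose L (s x : R) := (1 - s) * phi x + s * psi x.
have L_out (s : I01 R) x : same_end (phi x) (psi x) -> outer (L (set_val s) x).
  have /andP[s0 s1] := I01_itv s; rewrite /L /outer.
  by move=> /orP[/andP[p0 q0]|/andP[p0 q0]]; apply/orP; [left|right]; nra.
apply: (@cube_homotopic a b
  (fun p => c (sphere_pi (put i p.2 (L (set_val p.1) (cube_coord p.2 i)))))).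
- apply: bmap_pi_continuous; apply: put_continuous; first exact: snd_continuous.
  have cs : continuous (fun p : I01 R * cube R n.+1 => set_val p.1 : R).
    exact: (comp_continuous (@fst_continuous _ _) (@I01_val_continuous R)).
  have cx : continuous (fun p : I01 R * cube R n.+1 => cube_coord p.2 i).
    exact: (comp_continuous (@snd_continuous _ _) (@cube_coord_continuous R n.+1 i)).
  move=> p; rewrite /L; apply: cvgD; apply: cvgM.
  + by apply: cvgB; [exact: cvg_cst|exact: cs].
  + exact: (comp_continuous cx cphi).
  + exact: cs.
  + exact: (comp_continuous cx cpsi).
- by move=> t; rewrite ha /L /= I0E subr0 mul1r mul0r addr0.
- by move=> t; rewrite hb /L /= I1E subrr mul0r mul1r add0r.
- move=> s t bt /=; rewrite bmap_boundary//.
  by apply: put_boundary => // ->; exact: L_out.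
Qed.

Lemma concat_pi a b t : concat a b (sphere_pi t) =
  if cube_coord t ord0 <= 2^-1 then a (sphere_pi (put ord0 t (2 * cube_coord t ord0)))
  else b (sphere_pi (put ord0 t (2 * cube_coord t ord0 - 1))).
Proof. by rewrite [LHS]sphere_bmap_pi /concat_cube !reparam_put. Qed.

Lemma reverse_pi a t :
  reverse a (sphere_pi t) = a (sphere_pi (put ord0 t (1 - cube_coord t ord0))).
Proof. by rewrite [LHS]sphere_bmap_pi /reverse_cube reparam_put. Qed.

Lemma max_continuous (f g : R -> R) : continuous f -> continuous g ->
  continuous (fun x => Num.max (f x) (g x)).
Proof. by move=> cf cg x; exact: continuous_max (cf x) (cg x). Qed.

Lemma double_continuous : continuous (fun x : R => 2 * x).
Proof. by move=> x; apply: cvgM; [exact: cvg_cst|exact: cvg_id]. Qed.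

Lemma double_sub1_continuous : continuous (fun x : R => 2 * x - 1).
Proof. by move=> x; apply: cvgB; [exact: double_continuous|exact: cvg_cst]. Qed.

(** The two homotopies are concatenated at each time; they meet at the base point. This makes the
    product of classes computable on any representatives. *)
Lemma concat_homotopic a a' b b' : homotopic R a a' -> homotopic R b b' ->
  homotopic R (concat a b) (concat a' b').
Proof.
move=> [F [cF Fa Fa' Fpt]] [G [cG Gb Gb' Gpt]].
pose x0 (p : I01 R * cube R n.+1) := cube_coord p.2 ord0.
have cx0 : continuous x0.
  exact: (comp_continuous (@snd_continuous _ _) (@cube_coord_continuous R n.+1 ord0)).
have cput (phi : R -> R) (K : I01 R * sphere R n.+1 -> X) :
    continuous phi -> continuous K ->
    continuous (fun p => K (p.1, sphere_pi (put ord0 p.2 (phi (x0 p))))).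
  move=> cphi cK; apply: (comp_continuous _ cK).
  apply: pair_continuous; first exact: fst_continuous.
  apply: (comp_continuous _ (@sphere_pi_continuous R _)).
  apply: put_continuous; first exact: snd_continuous.
  exact: (comp_continuous cx0 cphi).
apply: (@cube_homotopic _ _ (fun p => if x0 p <= 2^-1
   then F (p.1, sphere_pi (put ord0 p.2 (2 * x0 p)))
   else G (p.1, sphere_pi (put ord0 p.2 (2 * x0 p - 1))))).
- apply: if_continuous => //.
  + exact: cput double_continuous cF.
  + exact: cput double_sub1_continuous cG.
  + move=> p ->; rewrite !sphere_pi_boundary ?Fpt ?Gpt//; apply: put_outer;
    apply/orP; [left|right]; lra.
- by move=> t; rewrite concat_pi /x0 /= Fa Gb.
- by move=> t; rewrite concat_pi /x0 /= Fa' Gb'.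
- move=> s t bt; rewrite /x0 /=; case: leP => h;
  rewrite sphere_pi_boundary ?Fpt ?Gpt//; apply: put_boundary => // tE;
  rewrite /outer tE in h *; apply/orP; by [left; lra|right; lra].
Qed.

Lemma concat_cst a : homotopic R (concat (bmap_cst _ _) a) a.
Proof.
(* On the first half [2 * x - 1] is at most 0, so [a] takes the base point there, as the constant
   map does. *)
apply: (@put_homotopic _ _ a ord0 (fun x => 2 * x - 1) id).
- exact: double_sub1_continuous.
- by move=> x; exact: cvg_id.
- by apply/orP; left; apply/andP; split; lra.
- by apply/orP; right; apply/andP; split; lra.
- move=> t; rewrite concat_pi; case: leP => // h.
  by rewrite [RHS]bmap_outer//; apply/orP; left; lra.
- by move=> t; rewrite put_coord.
Qed.

Lemma concat_reverse a : homotopic R (concat (reverse a) a) (bmap_cst _ _).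
Proof.
(* The maximum is the absolute value of [2 * x - 1]: [a] is run from 1 to 0 and back. It is deformed
   to the constant 1, where [a] is at the base point. *)
apply: (@put_homotopic _ _ a ord0 (fun x => Num.max (1 - 2 * x) (2 * x - 1)) (fun=> 1)).
- apply: max_continuous; last exact: double_sub1_continuous.
  by move=> x; apply: cvgB; [exact: cvg_cst|exact: double_continuous].
- by move=> x; exact: cvg_cst.
- by apply/orP; right; rewrite le_max lexx andbT; apply/orP; left; lra.
- by apply/orP; right; rewrite le_max lexx andbT; apply/orP; right; lra.
- move=> t; rewrite concat_pi; case: leP => h.
    rewrite reverse_pi coord_put eqxx put_put max_l; last lra.
    by rewrite clampE//; have := coord_itv t ord0; lra.
  by rewrite max_r//; lra.
- by move=> t; rewrite bmap_outer// /outer lexx orbT.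
Qed.

Lemma concat_put a b t x : 0 <= x <= 1 -> concat a b (sphere_pi (put ord0 t x)) =
  if x <= 2^-1 then a (sphere_pi (put ord0 t (2 * x)))
  else b (sphere_pi (put ord0 t (2 * x - 1))).
Proof. by move=> x01; rewrite concat_pi coord_put eqxx clampE// !put_put. Qed.

Lemma concatA a b c :
  homotopic R (concat a (concat b c)) (concat (concat a b) c).
Proof.
(* The piecewise affine map with slopes 1/2, 1, 2 carrying the breakpoints 1/2, 3/4 of the left side
   to the breakpoints 1/4, 1/2 of the right side. It is convex, hence the maximum of its three
   affine pieces. *)
pose phi (x : R) := Num.max (2^-1 * x) (Num.max (x - 4^-1) (2 * x - 1)).
apply: (@put_homotopic _ _ (concat (concat a b) c) ord0 phi id).
- apply: max_continuous; first by move=> x; apply: cvgM; [exact: cvg_cst|exact: cvg_id].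
  apply: max_continuous; last exact: double_sub1_continuous.
  by move=> x; apply: cvgB; [exact: cvg_id|exact: cvg_cst].
- by move=> x; exact: cvg_id.
- by apply/orP; left; rewrite lexx andbT !ge_max; apply/and3P; split; lra.
- apply/orP; right; rewrite lexx andbT !le_max.
  by apply/orP; right; apply/orP; right; lra.
- move=> t; have := coord_itv t ord0; rewrite concat_pi /phi.
  set x := cube_coord t ord0 => /andP[x0 x1].
  case: leP => h.
    rewrite [Num.max _ _]max_l ?ge_max; last by apply/andP; split; lra.
    rewrite concat_put ?ifT; [|lra|by apply/andP; split; lra].
    rewrite concat_put ?ifT; [|lra|by apply/andP; split; lra].
    by congr (a (sphere_pi (put _ _ _))); field.
  rewrite [Num.max _ _]max_r ?le_max; last by apply/orP; left; lra.
  rewrite concat_put; last by apply/andP; split; lra.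
  case: leP => h'.
    rewrite max_l; last lra.
    rewrite concat_put ?ifT; [|lra|by apply/andP; split; lra].
    rewrite concat_put ?ifF;
      [|by apply/negbTE; rewrite -ltNge; lra|by apply/andP; split; lra].
    by congr (b (sphere_pi (put _ _ _))); field.
  rewrite max_r; last lra.
  by rewrite concat_put ?ifF //;
    [apply/negbTE; rewrite -ltNge; lra|apply/andP; split; lra].
- by move=> t; rewrite put_coord.
Qed.

(* Eckmann-Hilton: [a] is pushed into the half [t i <= 1/2] of the cube and [b] into the
   half [1/2 <= t i], where they slide past each other in the direction of the
   coordinate [ord0]. *)
Lemma concatC (i : 'I_n.+1) a b :
  i != ord0 -> homotopic R (concat a b) (concat b a).
Proof.
move=> i0.
have squeeze c (phi : R -> R) : continuous phi ->
    same_end (phi 0) 0 -> same_end (phi 1) 1 ->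
    exists2 c', homotopic R c c' & forall t,
      c' (sphere_pi t) = c (sphere_pi (put i t (phi (cube_coord t i)))).
  move=> cphi end0 end1; pose f t := c (sphere_pi (put i t (phi (cube_coord t i)))).
  have cf : continuous f.
    apply: bmap_pi_continuous; apply: put_continuous; first by move=> ?; exact: cvg_id.
    exact: (comp_continuous (@cube_coord_continuous R n.+1 i) cphi).
  have f0 t : cube_boundary t -> f t = point.
    move=> bt; rewrite /f bmap_boundary//; apply: put_boundary => // ->.
      by move: end0 => /orP[]/andP[h _]; rewrite /outer h ?orbT.
    by move: end1 => /orP[]/andP[h _]; rewrite /outer h ?orbT.
  exists (sphere_bmap cf f0) => [|t]; last exact: sphere_bmap_pi.
  apply/homotopic_sym; apply: (@put_homotopic _ _ c i phi id) => //.
  - by move=> x; exact: cvg_id.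
  - exact: sphere_bmap_pi.
  - by move=> t; rewrite put_coord.
(* [2 * y] clamps to 1 on the upper half, so [a'] is at the base point there; likewise [b'], with
   [2 * y - 1], on the lower half. *)
have [||a' aa' a'E] := squeeze a _ double_continuous.
- by apply/orP; left; apply/andP; split; lra.
- by apply/orP; right; apply/andP; split; lra.
have [||b' bb' b'E] := squeeze b _ double_sub1_continuous.
- by apply/orP; left; apply/andP; split; lra.
- by apply/orP; right; apply/andP; split; lra.
apply: (homotopic_trans (concat_homotopic aa' bb')).
apply: homotopic_trans (homotopic_sym (concat_homotopic bb' aa')).
(* As the time [s] goes from 0 to 1, the copy of [a] slides from the first half of coordinate [ord0]
   to the second, and the copy of [b] slides the opposite way. *)
pose M (p : I01 R * cube R n.+1) := let: (s, t) := p in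
  let x := cube_coord t ord0 in let y := cube_coord t i in
  if y <= 2^-1 then a (sphere_pi (put ord0 (put i t (2 * y)) (2 * x - set_val s)))
  else b (sphere_pi (put ord0 (put i t (2 * y - 1)) (2 * x - 1 + set_val s))).
have ME s t : M (s, t) = let x := cube_coord t ord0 in let y := cube_coord t i in
  if y <= 2^-1 then a (sphere_pi (put ord0 (put i t (2 * y)) (2 * x - set_val s)))
  else b (sphere_pi (put ord0 (put i t (2 * y - 1)) (2 * x - 1 + set_val s))) by [].
have i0' : (ord0 == i) = false by rewrite eq_sym (negbTE i0).
have aE t x y : outer y -> a (sphere_pi (put ord0 (put i t y) x)) = point.
  by move=> y_out; rewrite -putC// bmap_outer.
have bE t x y : outer y -> b (sphere_pi (put ord0 (put i t y) x)) = point.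
  by move=> y_out; rewrite -putC// bmap_outer.
apply: (@cube_homotopic _ _ M).
- have cs : continuous (fun p : I01 R * cube R n.+1 => set_val p.1 : R).
    exact: (comp_continuous (@fst_continuous _ _) (@I01_val_continuous R)).
  have cx j : continuous (fun p : I01 R * cube R n.+1 => cube_coord p.2 j).
    exact: (comp_continuous (@snd_continuous _ _) (@cube_coord_continuous R n.+1 j)).
  have -> : M = fun p => if cube_coord p.2 i <= 2^-1
    then a (sphere_pi (put ord0 (put i p.2 (2 * cube_coord p.2 i))
                         (2 * cube_coord p.2 ord0 - set_val p.1)))
    else b (sphere_pi (put ord0 (put i p.2 (2 * cube_coord p.2 i - 1))
                         (2 * cube_coord p.2 ord0 - 1 + set_val p.1))).
    by apply/funext => -[].
  apply: if_continuous => //.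
  + apply: bmap_pi_continuous; apply: put_continuous.
      apply: put_continuous; first exact: snd_continuous.
      exact: comp_continuous (cx i) double_continuous.
    move=> p; apply: cvgB; last exact: cs.
    exact: (comp_continuous (cx ord0) double_continuous).
  + apply: bmap_pi_continuous; apply: put_continuous.
      apply: put_continuous; first exact: snd_continuous.
      exact: comp_continuous (cx i) double_sub1_continuous.
    move=> p; apply: cvgD; last exact: cs.
    exact: (comp_continuous (cx ord0) double_sub1_continuous).
  + move=> p ->; rewrite aE ?bE//; apply/orP; [left|right]; lra.
(* In two of the four quarters cut out by the coordinates [ord0] and [i] the formulas coincide; in
   the other two both sides are at the base point. *)
- move=> t; rewrite ME concat_pi /= I0E subr0 addr0 a'E b'E !coord_put.
  rewrite (negbTE i0) !(putC _ _ _ i0); case: leP => hx; case: leP => hy //.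
  + by rewrite [LHS]bmap_outer ?[RHS]bE//; apply/orP; [left|right]; lra.
  + by rewrite [LHS]bmap_outer ?[RHS]aE//; apply/orP; [right|left]; lra.
- move=> t; rewrite ME concat_pi /= I1E subrK a'E b'E !coord_put.
  rewrite (negbTE i0) !(putC _ _ _ i0); case: leP => hx; case: leP => hy //.
  + by rewrite [LHS]bmap_outer ?[RHS]bE//; apply/orP; left; lra.
  + by rewrite [LHS]bmap_outer ?[RHS]aE//; apply/orP; right; lra.
- move=> s t bt; rewrite ME /=; have /andP[s0 s1] := I01_itv s.
  case: leP => h; rewrite bmap_boundary//; apply: put_boundary;
    rewrite ?coord_put ?i0'; try by [move=> ->; apply/orP; left; lra
                                     |move=> ->; apply/orP; right; lra].
  all: apply: put_boundary => // tE; rewrite tE in h *;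
    by [apply/orP; left; lra|apply/orP; right; lra].
Qed.

End sphere_homotopy.

Section homotopy_group_laws.
Context (R : realType) (n : nat) (X : ptopologicalType).
Implicit Types (a b : bmap (sphere R n.+1) X) (u v : homotopy_group R n X).

Lemma hclassP a b : homotopic R a b <-> hclass a = hclass b.
Proof.
have := eqmodP (@homotopicb_equiv R (sphere R n.+1) X) a b.
by split=> [/asboolP/H //|/H/asboolP].
Qed.

Lemma hclass_repr u : hclass (repr u) = u.
Proof. exact: reprK. Qed.

Lemma hclassM a b : (hclass a * hclass b)%g = hclass (concat a b).
Proof. by apply/hclassP/concat_homotopic; apply/hclassP; rewrite hclass_repr. Qed.

Lemma homotopy_mulA : associative (fun u v => u * v)%g.
Proof.
move=> u v w; rewrite -(hclass_repr u) -(hclass_repr v) -(hclass_repr w) !hclassM.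
by apply/hclassP; exact: concatA.
Qed.

Lemma homotopy_mul1 : left_id (1%g : homotopy_group R n X) (fun u v => u * v)%g.
Proof.
by move=> u; rewrite -(hclass_repr u) [LHS]hclassM; apply/hclassP; exact: concat_cst.
Qed.

Lemma homotopy_mulV : left_inverse (1%g : homotopy_group R n X)
  (fun u => u^-1)%g (fun u v => u * v)%g.
Proof.
move=> u; rewrite -[X in (_ * X)%g]hclass_repr [LHS]hclassM.
by apply/hclassP; exact: concat_reverse.
Qed.

End homotopy_group_laws.

(** Index [n.+1] is degree at least 2, so the cube has a coordinate [ord_max] distinct from
    [ord0]. *)
Lemma homotopy_mulC (R : realType) (n : nat) (X : ptopologicalType) :
  commutative (fun u v : homotopy_group R n.+1 X => u * v)%g.
Proof.
move=> u v; rewrite -(hclass_repr u) -(hclass_repr v) !hclassM.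
by apply/hclassP; apply: (@concatC _ _ _ ord_max).
Qed.

Lemma rational_abelian_laws (R : realType) (n : nat) (X : ptopologicalType) :
  rational_space R X -> abelian_laws (homotopy_group R n X).
Proof.
move=> [[_ pi1] _ _]; split.
- exact: homotopy_mulA.
(* Index 0 is the fundamental group, trivial by simple connectivity. *)
- case: n => [u v|n]; last exact: homotopy_mulC.
  by rewrite [LHS]pi1 [RHS]pi1.
- exact: homotopy_mul1.
- exact: homotopy_mulV.
Qed.

(** * Induced homomorphisms and products in Gottlieb groups *)

Section pi_map.
Context (R : realType) (n : nat).

Lemma bmap_comp_homotopic (X Y Z : ptopologicalType) (f f' : bmap Y Z) (g g' : bmap X Y) :
  homotopic R f f' -> homotopic R g g' ->
  homotopic R (bmap_comp f g) (bmap_comp f' g').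
Proof.
move=> [F [cF Ff Ff' Fpt]] [G [cG Gg Gg' Gpt]].
exists (fun p => F (p.1, G p)); split=> [|x|x|t] /=.
- apply: (comp_continuous _ cF); apply: pair_continuous => //.
  exact: fst_continuous.
- by rewrite Gg Ff.
- by rewrite Gg' Ff'.
- by rewrite Gpt Fpt.
Qed.

(** Avoids comparing the proofs stored in the two records. *)
Lemma eq_homotopic (X Y : ptopologicalType) (f f' : bmap X Y) :
  f =1 f' -> homotopic R f f'.
Proof.
move=> ff'; have [H [cH H0 H1 Hpt]] := @homotopic_refl R _ _ f.
by exists H; split=> // x; rewrite H1.
Qed.

Context (X Y : ptopologicalType).
Implicit Types (f : bmap X Y) (u v : homotopy_group R n X).

Lemma pi_map_hclass f a :
  pi_map f (hclass a) = hclass (bmap_comp f a) :> homotopy_group R n Y.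
Proof.
apply/hclassP/bmap_comp_homotopic; first exact: homotopic_refl.
by apply/hclassP; rewrite hclass_repr.
Qed.

Lemma pi_map_homotopic f f' : homotopic R f f' -> pi_map (R := R) (n := n) f =1 pi_map f'.
Proof.
move=> ff' u; apply/hclassP/bmap_comp_homotopic => //; exact: homotopic_refl.
Qed.

(** Composing with [f] commutes with concatenation pointwise. *)
Lemma pi_mapM f u v : pi_map f (u * v)%g = (pi_map f u * pi_map f v)%g.
Proof.
rewrite [in LHS](_ : (u * v)%g = hclass (concat (repr u) (repr v)))//.
rewrite pi_map_hclass [RHS]hclassM; apply/hclassP/eq_homotopic => x.
rewrite -[x]reprK -/(sphere_pi (repr x)) [RHS]concat_pi /=.
by rewrite [X in f X]concat_pi; case: ifP.
Qed.

(** The induction starts at exponent 1, so multiplicativity alone suffices. *)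
Lemma pi_mapX f u k : (0 < k)%N -> pi_map f (u ^+ k)%g = (pi_map f u ^+ k)%g.
Proof. by case: k => // k _; elim: k => // k IH; rewrite expgSS pi_mapM IH. Qed.

End pi_map.

Lemma pi_map_comp (R : realType) (n : nat) (X Y Z : ptopologicalType)
    (f : bmap Y Z) (g : bmap X Y) (u : homotopy_group R n X) :
  pi_map (bmap_comp f g) u = pi_map f (pi_map g u).
Proof.
by rewrite [pi_map g u]/pi_map pi_map_hclass; apply/hclassP/eq_homotopic.
Qed.

(** The extensions [F] and [G] are concatenated in the sphere variable; they fit together because
    both restrict to the identity of [B] over the base point of the sphere. *)
Lemma gottliebM (R : realType) (n : nat) (B : ptopologicalType)
    (u v : homotopy_group R n B) :
  gottlieb R n B u -> gottlieb R n B v -> gottlieb R n B (u * v)%g.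
Proof.
move=> [a -> [F [cF Fa Fb]]] [b -> [G [cG Gb Gid]]]; rewrite hclassM.
exists (concat a b) => //.
pose H (p : cube R n.+1 * B) := if cube_coord p.1 ord0 <= 2^-1
   then F (sphere_pi (put ord0 p.1 (2 * cube_coord p.1 ord0)), p.2)
   else G (sphere_pi (put ord0 p.1 (2 * cube_coord p.1 ord0 - 1)), p.2).
(* This one fact lets [H] descend to the sphere and shows that it extends the identity of [B]. *)
have H_boundary t x : cube_boundary t -> H (t, x) = x.
  move=> bt; rewrite /H /=; case: leP => h; rewrite sphere_pi_boundary ?Fb ?Gid//;
  apply: put_boundary => // tE; rewrite tE in h *;
    by [apply/orP; left; lra|apply/orP; right; lra].
exists (fun p => H (repr p.1, p.2)); split=> [|s|x].
- apply: sphere_prod_continuous => [|s t x bs bt]; last by rewrite !H_boundary.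
  have cx0 : continuous (fun p : cube R n.+1 * B => cube_coord p.1 ord0).
    exact: (comp_continuous (@fst_continuous _ _) (@cube_coord_continuous R n.+1 ord0)).
  have cput (phi : R -> R) (K : sphere R n.+1 * B -> B) :
      continuous phi -> continuous K -> continuous (fun p : cube R n.+1 * B =>
        K (sphere_pi (put ord0 p.1 (phi (cube_coord p.1 ord0))), p.2)).
    move=> cphi cK; apply: (comp_continuous _ cK).
    apply: pair_continuous; last exact: snd_continuous.
    apply: (comp_continuous _ (@sphere_pi_continuous R _)).
    apply: put_continuous; first exact: fst_continuous.
    exact: (comp_continuous cx0 cphi).
  apply: if_continuous => //.
  + exact: cput (@double_continuous R) cF.
  + exact: cput (@double_sub1_continuous R) cG.
  + move=> p ->; rewrite !sphere_pi_boundary ?Fb ?Gid//; apply: put_outer;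
    apply/orP; [left|right]; lra.
- rewrite -[in RHS](reprK s) -/(sphere_pi (repr s)) concat_pi /H /=.
  by rewrite Fa Gb.
- by rewrite H_boundary// repr_sphere_point.
Qed.

(** * Subadditivity, degree by degree *)

Local Open Scope ereal_scope.

Theorem theorem1p2 (R : realType) (X Y Z : ptopologicalType)
    (X_simply_connected : simply_connected R X) (X_cw : cw_complex R X)
    (X_finite_type : rational_finite_type R X)
    (Y_simply_connected : simply_connected R Y) (Y_cw : cw_complex R Y)
    (Y_finite_type : rational_finite_type R Y)
    (Z_simply_connected : simply_connected R Z) (Z_cw : cw_complex R Z)
    (Z_finite_type : rational_finite_type R Z)
    (XQ YQ ZQ : ptopologicalType)
    (lX : bmap X XQ) (lY : bmap Y YQ) (lZ : bmap Z ZQ)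
    (lX_rat : rationalization R lX) (lY_rat : rationalization R lY)
    (lZ_rat : rationalization R lZ)
    (GX_fin : dimG R XQ < +oo) (GY_fin : dimG R YQ < +oo)
    (g : bmap X Y) (f : bmap Y Z)
    (gQ : bmap XQ YQ) (fQ : bmap YQ ZQ) (fgQ : bmap XQ ZQ)
    (gQ_rat : rationalization_map R lX lY g gQ)
    (fQ_rat : rationalization_map R lY lZ f fQ)
    (fgQ_rat : rationalization_map R lX lZ (bmap_comp f g) fgQ) :
  dimO R fgQ <= dimO R fQ + dimO R gQ.
Proof.
have [YQ_rat _ _] := lY_rat; have [ZQ_rat _ _] := lZ_rat; have [_ lX_surj _] := lX_rat.
have fgQE n (v : homotopy_group R n XQ) : pi_map fgQ v = pi_map fQ (pi_map gQ v).
  (* A positive power of [v] comes from [X], and taking this power is injective in [ZQ], so it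
     suffices to compare [fgQ] and [fQ] after [gQ] on classes from [X]. *)
  have [k k0 [u uv]] := lX_surj n v; have [_ _ /(_ n k k0)/bij_inj] := ZQ_rat.
  apply; rewrite /= -!pi_mapX// uv -!pi_map_comp; apply: pi_map_homotopic.
  (* The chain passes through [lZ] after [f] after [g], then [fQ] after [lY] after [g], then [fQ]
     after [gQ] after [lX]; the intermediate links only reassociate. *)
  apply: homotopic_trans fgQ_rat _.
  apply: (@homotopic_trans _ _ _ (bmap_comp (bmap_comp lZ f) g)); first exact: eq_homotopic.
  apply: (@homotopic_trans _ _ _ (bmap_comp (bmap_comp fQ lY) g)).
    exact: bmap_comp_homotopic (homotopic_sym fQ_rat) (homotopic_refl R g).
  apply: (@homotopic_trans _ _ _ (bmap_comp fQ (bmap_comp lY g))); first exact: eq_homotopic.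
  apply: (@homotopic_trans _ _ _ (bmap_comp fQ (bmap_comp gQ lX))); last exact: eq_homotopic.
  exact: bmap_comp_homotopic (homotopic_refl R fQ) (homotopic_sym gQ_rat).
(* The terms are nonnegative, so the two series add termwise and the inequality may be checked in
   each degree. *)
rewrite /dimO -nneseriesD; [|by move=> n _ _; exact: qdim_ge0..].
apply: lee_nneseries => n *; first exact: qdim_ge0.
have -> : pi_map fgQ @` gottlieb R n XQ = pi_map fQ @` (pi_map gQ @` gottlieb R n XQ).
  by rewrite image_comp; congr (_ @` _); apply/funext => v; exact: fgQE.
apply: qdim_image_le.
- exact: rational_abelian_laws YQ_rat.
- exact: rational_abelian_laws ZQ_rat.
- exact: pi_mapM.
- exact: gottliebM.
- exact: gottliebM.
Qed.
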